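(* Let $d\ge1$, $p\in(0,1)$, and let $\varepsilon$ satisfy $d^{-(2-p)/(2p)}\le\varepsilon\le1$. Set $s=s(p,\varepsilon)=\big\lceil\varepsilon^{-\frac{2p}{2-p}}\big\rceil$. Then $$\varepsilon\,\mathrm{conv}_p\big(\mathsf B^d_0(s)\cap\mathsf B^d_2\big)\ \subset\ \mathcal C_d(p,\varepsilon)\ \subset\ 3\varepsilon\,\mathrm{conv}\big(\mathsf B^d_0(s)\cap\mathsf B^d_2\big),$$ and consequently, for $\xi\sim\mathsf N(0,I_d)$, $$\varepsilon^2\,\mathbf E\Big[\max_{S\subset[d],\,|S|\le s}\|\xi_S\|_2^2\Big]\ \le\ \mathbf E\Big[\Big(\sup_{x\in\mathcal C_d(p,\varepsilon)}\langle x,\xi\rangle\Big)^2\Big]\ \le\ 9\varepsilon^2\,\mathbf E\Big[\max_{S\subset[d],\,|S|\le s}\|\xi_S\|_2^2\Big].$$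
   Context: $\|x\|_p^p=\sum_i|x_i|^p$; $\|x\|_0$ is the number of nonzero entries of $x$; $\mathsf B^d_0(s)=\{x\in\mathbf R^d:\|x\|_0\le s\}$; $\mathsf B^d_2$ is the closed Euclidean unit ball; $[d]=\{1,\dots,d\}$; $\xi_S$ is the restriction of $\xi$ to coordinates in $S$. The localized set is $$\mathcal C_d(p,\varepsilon)=\{x\in\mathbf R^d:\ \|x\|_p^p\le2,\ \|x\|_2\le\varepsilon\}.$$ $\mathrm{conv}(T)$ is the convex hull, and the $p$th order convex hull of $T\subset\mathbf R^d$ is $$\mathrm{conv}_p(T)=\Big\{\sum_{j=1}^m\lambda_jt_j:\ m\in\mathbf N,\ t_j\in T,\ \lambda_j\ge0,\ \sum_{j=1}^m\lambda_j^p=1\Big\}.$$ *)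

(* Defs.v *)
From HB Require Import structures.
From mathcomp Require Import all_boot all_order all_algebra.
From mathcomp Require Import all_classical all_reals all_analysis.

Set Implicit Arguments.
Unset Strict Implicit.
Unset Printing Implicit Defensive.

Import Order.TTheory GRing.Theory Num.Theory.
Import numFieldNormedType.Exports.

Local Open Scope classical_set_scope.
Local Open Scope ring_scope.

(* Vectors of R^d are row vectors 'rV[R]_d. The norm `|x| that the library puts
   on them is the sup norm, hence the explicit norms below. *)

(* The p-th power ||x||_p^p, for p > 0. *)
Definition lp_normp (R : realType) (d : nat) (p : R) (x : 'rV[R]_d) : R :=
  \sum_(i < d) `|x 0 i| `^ p.

Definition l2_norm (R : realType) (d : nat) (x : 'rV[R]_d) : R :=
  Num.sqrt (\sum_(i < d) x 0 i ^+ 2).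

Definition l0_norm (R : realType) (d : nat) (x : 'rV[R]_d) : nat :=
  #|[set i : 'I_d | x 0 i != 0]%SET|.

Definition inner (R : realType) (d : nat) (x y : 'rV[R]_d) : R :=
  \sum_(i < d) x 0 i * y 0 i.

Definition B0 (R : realType) (d s : nat) : set 'rV[R]_d :=
  [set x | (l0_norm x <= s)%N].

Definition B2 (R : realType) (d : nat) : set 'rV[R]_d :=
  [set x | l2_norm x <= 1].

Arguments B0 : clear implicits.
Arguments B2 : clear implicits.

Definition localized_set (R : realType) (d : nat) (p eps : R) : set 'rV[R]_d :=
  [set x | lp_normp p x <= 2 /\ l2_norm x <= eps].

Arguments localized_set {R} d p eps.

Definition conv_hull (R : realType) (V : lmodType R) (A : set V) : set V :=
  [set x | exists (m : nat) (lambda : 'I_m -> R) (t : 'I_m -> V),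
    [/\ forall j, A (t j), forall j, 0 <= lambda j,
        \sum_(j < m) lambda j = 1 & x = \sum_(j < m) lambda j *: t j]].

Definition conv_hull_p (R : realType) (V : lmodType R) (p : R) (A : set V) :
    set V :=
  [set x | exists (m : nat) (lambda : 'I_m -> R) (t : 'I_m -> V),
    [/\ forall j, A (t j), forall j, 0 <= lambda j,
        \sum_(j < m) lambda j `^ p = 1 & x = \sum_(j < m) lambda j *: t j]].

Definition scale_set (R : realType) (V : lmodType R) (c : R) (A : set V) :
    set V :=
  [set c *: x | x in A].

(* The argument of the ceiling is nonnegative, so the absolute value only
   serves to turn the integer ceiling into a natural number. *)
Definition sparsity (R : realType) (p eps : R) : nat :=
  `|Num.ceil (eps `^ (- (2 * p / (2 - p))))|%N.

(* x_S, padded with zeros outside of S. *)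
Definition restrict_to (R : realType) (d : nat) (S : {set 'I_d})
    (x : 'rV[R]_d) : 'rV[R]_d :=
  \row_(i < d) (if i \in S then x 0 i else 0).

(* The default value 0 of the iterated maximum is harmless: S = set0 is allowed
   and contributes 0. *)
Definition max_sparse_sqnorm (R : realType) (d s : nat) (x : 'rV[R]_d) : R :=
  \big[Num.max/0]_(S : {set 'I_d} | (#|S| <= s)%N) l2_norm (restrict_to S x) ^+ 2.

(* sup is the real supremum, by convention 0 when A is empty or when the inner
   products are not bounded above. *)
Definition support_fun (R : realType) (d : nat) (A : set 'rV[R]_d)
    (y : 'rV[R]_d) : R :=
  sup [set inner x y | x in A].

Definition mutually_independent (R : realType) (dT : measure_display)
    (T : measurableType dT) (P : probability T R) (d : nat)
    (X : 'I_d -> {RV P >-> R}) : Prop :=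
  forall (J : {set 'I_d}) (A : 'I_d -> set R), (forall i, measurable (A i)) ->
    P [set w | forall i, i \in J -> A i (X i w)] =
    (\prod_(i in J) P (X i @^-1` A i))%E.

Definition std_gaussian (R : realType) (dT : measure_display)
    (T : measurableType dT) (P : probability T R) (d : nat)
    (X : 'I_d -> {RV P >-> R}) : Prop :=
  mutually_independent X /\
  forall (i : 'I_d) (A : set R), measurable A ->
    distribution P (X i) A = normal_prob 0 1 A.

Definition random_row (R : realType) (dT : measure_display)
    (T : measurableType dT) (P : probability T R) (d : nat)
    (X : 'I_d -> {RV P >-> R}) (w : T) : 'rV[R]_d :=
  \row_(i < d) X i w.

(* Main.v *)
(* Left inclusion: |.|_p^p is subadditive and an s-sparse unit vector has
   |t|_p^p <= s^(1-p/2); since s is at most twice eps^(-2p/(2-p)), the total is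
   at most 2^(1-p/2) <= 2.
   Right inclusion: (2-p) v <= v^p + (1-p) v^2 with v = |x_i| / eps^(2/(2-p))
   gives |x|_1 <= 2 sqrt(s) eps on the localized set. Cut x into blocks of s
   coordinates of decreasing magnitude: the first block has Euclidean norm at
   most eps, the others together at most |x|_1 / sqrt(s) <= 2 eps.
   The inclusions compare the support function of the localized set at y with
   the maximal norm of y_S, pointwise in y; square and integrate. *)

Require Import Defs.
From HB Require Import structures.
From mathcomp Require Import all_boot all_order all_algebra.
From mathcomp Require Import all_classical all_reals all_analysis.
From mathcomp Require Import measurable_realfun.
From mathcomp Require Import ring lra.

Set Implicit Arguments.
Unset Strict Implicit.
Unset Printing Implicit Defensive.

Import Order.TTheory GRing.Theory Num.Theory.
Import numFieldNormedType.Exports.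

Local Open Scope classical_set_scope.
Local Open Scope ring_scope.

(** * Two inequalities for real powers *)

(** Young's inequality with conjugate exponents 1/a and 1/(1-a), applied to x^a and y^(1-a). *)
Lemma weighted_AMGM (R : realType) (a x y : R) :
  0 < a -> a < 1 -> 0 <= x -> 0 <= y ->
  x `^ a * y `^ (1 - a) <= a * x + (1 - a) * y.
Proof.
move=> a0 a1 x0 y0; have b0 : 0 < 1 - a by rewrite subr_gt0.
have := @conjugate_powR R (x `^ a) (y `^ (1 - a)) a^-1 (1 - a)^-1.
rewrite !invrK -!powRrM !divff ?gt_eqF// !powRr1// ![_ * a]mulrC [y * _]mulrC.
by apply; rewrite ?powR_ge0 ?invr_gt0// addrC subrK.
Qed.

(** With A the total, each ratio a_i/A lies in [0,1] and so is at most its p-th power; multiply by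
    A^p and sum. *)
Lemma powR_le_sum (R : realType) (p : R) (I : finType) (a : I -> R) :
  0 < p -> p <= 1 -> (forall i, 0 <= a i) ->
  (\sum_i a i) `^ p <= \sum_i a i `^ p.
Proof.
move=> p0 p1 a0; have [A0|A0] := eqVneq (\sum_i a i) 0.
  by rewrite A0 powR0 ?gt_eqF// sumr_ge0// => i _; exact: powR_ge0.
have Agt0 : 0 < \sum_i a i by rewrite lt_neqAle eq_sym A0 sumr_ge0.
set A := \sum_i a i in A0 Agt0 *.
have key i : A `^ p * (a i / A) <= a i `^ p.
  have [ai0|ai0] := eqVneq (a i) 0; first by rewrite ai0 mul0r mulr0 powR_ge0.
  have aiA : a i <= A by rewrite /A (bigD1 i)//= lerDl sumr_ge0.
  have aigt0 : 0 < a i by rewrite lt_neqAle eq_sym ai0 a0.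
  have -> : a i `^ p = A `^ p * (a i / A) `^ p.
    by rewrite -powRM ?divr_ge0 ?ltW// mulrC divfK.
 
  rewrite ler_wpM2l ?powR_ge0// ger1_powR// divr_gt0//=.
  by rewrite ler_pdivrMr// mul1r.
have -> : A `^ p = \sum_i A `^ p * (a i / A).
  by rewrite -mulr_sumr -mulr_suml divff ?mulr1.
exact: ler_sum.
Qed.

(** * Euclidean norm, inner product and restriction to coordinates *)

Section euclidean.
Variables (R : realType) (d : nat).
Implicit Types (x y t : 'rV[R]_d) (S D : {set 'I_d}) (s : nat) (p c : R).

Lemma sqr_l2_norm x : l2_norm x ^+ 2 = \sum_(i < d) x 0 i ^+ 2.
Proof. by rewrite sqr_sqrtr// sumr_ge0// => i _; rewrite sqr_ge0. Qed.

Lemma l2_norm_ge0 x : 0 <= l2_norm x.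
Proof. exact: sqrtr_ge0. Qed.

Lemma l2_norm_le x c : 0 <= c ->
  (l2_norm x <= c) = (\sum_(i < d) x 0 i ^+ 2 <= c ^+ 2).
Proof.
by move=> c0; rewrite -sqr_l2_norm ler_sqr// nnegrE ?l2_norm_ge0.
Qed.

Lemma l2_norm_eq0 x : l2_norm x = 0 -> x = 0.
Proof.
move=> x0; have := sqr_l2_norm x; rewrite x0 expr0n/= => /esym/eqP.
rewrite psumr_eq0 => [/allP h|i _]; last exact: sqr_ge0.
apply/rowP => i; rewrite mxE; apply/eqP; rewrite -sqrf_eq0.
by apply: h; rewrite mem_index_enum.
Qed.

Lemma l2_norm0 : l2_norm (0 : 'rV[R]_d) = 0.
Proof.
rewrite /l2_norm big1 ?sqrtr0// => i _.
by rewrite mxE expr0n.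
Qed.

Lemma l2_normZ c x : l2_norm (c *: x) = `|c| * l2_norm x.
Proof.
rewrite /l2_norm (eq_bigr (fun i => c ^+ 2 * x 0 i ^+ 2)) => [|i _].
  by rewrite -mulr_sumr sqrtrM ?sqr_ge0// sqrtr_sqr.
by rewrite mxE exprMn.
Qed.

Lemma l0_normZ c x : (l0_norm (c *: x) <= l0_norm x)%N.
Proof.
apply/subset_leq_card/fintype.subsetP => i; rewrite !inE mxE mulf_eq0.
by rewrite negb_or => /andP[].
Qed.

Lemma inner_self x : inner x x = l2_norm x ^+ 2.
Proof. by rewrite sqr_l2_norm; apply: eq_bigr => i _; rewrite expr2. Qed.

Lemma inner_suml (I : Type) (r : seq I) (a : I -> R) (t : I -> 'rV[R]_d) y :
  inner (\sum_(j <- r) a j *: t j) y = \sum_(j <- r) a j * inner (t j) y.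
Proof.
under [RHS]eq_bigr do rewrite /inner mulr_sumr.
rewrite exchange_big/=; apply: eq_bigr => i _; rewrite summxE mulr_suml.
by apply: eq_bigr => j _; rewrite mxE mulrA.
Qed.

Lemma innerZl c x y : inner (c *: x) y = c * inner x y.
Proof. by rewrite mulr_sumr; apply: eq_bigr => i _; rewrite mxE mulrA. Qed.

(** Cauchy-Schwarz against the unit ball: with N the norm of x, expand (N t_i - x_i)^2 >= 0, divide
    by 2N and sum; each of the two terms contributes at most N/2. *)
Lemma inner_le_l2_norm t x : l2_norm t <= 1 -> inner t x <= l2_norm x.
Proof.
move=> t1; have [x0|x0] := eqVneq (l2_norm x) 0.
  rewrite x0 (l2_norm_eq0 x0) /inner big1// => i _.
  by rewrite mxE mulr0.
have N0 : 0 < l2_norm x by rewrite lt_neqAle eq_sym x0 l2_norm_ge0.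
set N := l2_norm x in x0 N0 *.
have h i : t 0 i * x 0 i <= N / 2 * t 0 i ^+ 2 + (2 * N)^-1 * x 0 i ^+ 2.
  have : 0 <= (2 * N)^-1 * (N * t 0 i - x 0 i) ^+ 2.
    by rewrite mulr_ge0 ?sqr_ge0// invr_ge0 mulr_ge0// ltW.
  suff -> : (2 * N)^-1 * (N * t 0 i - x 0 i) ^+ 2 =
    N / 2 * t 0 i ^+ 2 + (2 * N)^-1 * x 0 i ^+ 2 - t 0 i * x 0 i.
    by rewrite subr_ge0.
  by field.
apply: (le_trans (ler_sum _ (fun i _ => h i))).
rewrite big_split/= -!mulr_sumr -!sqr_l2_norm -/N.
have -> : (2 * N)^-1 * N ^+ 2 = N / 2 by field.
have : l2_norm t ^+ 2 <= 1 by rewrite expr_le1// l2_norm_ge0.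
nra.
Qed.

Lemma sum_restrict S x (f : R -> R) : f 0 = 0 ->
  \sum_(i < d) f (restrict_to S x 0 i) = \sum_(i in S) f (x 0 i).
Proof.
move=> f0; rewrite [RHS]big_mkcond; apply: eq_bigr => i _.
by rewrite mxE; case: ifP.
Qed.

Lemma sqr_l2_norm_restrict S x :
  l2_norm (restrict_to S x) ^+ 2 = \sum_(i in S) x 0 i ^+ 2.
Proof.
by rewrite sqr_l2_norm (sum_restrict _ _ (f := fun u => u ^+ 2)) ?expr0n.
Qed.

Lemma l2_norm_restrict_le S x : l2_norm (restrict_to S x) <= l2_norm x.
Proof.
rewrite l2_norm_le ?l2_norm_ge0// -sqr_l2_norm sqr_l2_norm_restrict.
rewrite sqr_l2_norm big_mkcond; apply: ler_sum => i _.
by case: ifP => _; rewrite ?sqr_ge0.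
Qed.

Lemma l0_norm_restrict S x : (l0_norm (restrict_to S x) <= #|S|)%N.
Proof.
apply/subset_leq_card/fintype.subsetP => i; rewrite !inE mxE.
by case: ifP => //; rewrite eqxx.
Qed.

Lemma inner_restrict S x y :
  inner (restrict_to S x) y = inner x (restrict_to S y).
Proof.
apply: eq_bigr => i _; rewrite !mxE.
by case: ifP; rewrite ?mul0r ?mulr0.
Qed.

Lemma restrict_support x : restrict_to [set i | x 0 i != 0]%SET x = x.
Proof.
apply/rowP => i; rewrite mxE inE.
by case: eqP.
Qed.

End euclidean.

(** Greedy choice: a maximiser of f over the elements left is added k times. Earlier picks still
    dominate whatever remains. *)
Lemma top_subset (R : realType) (I : finType) (f : I -> R) (D : {set I}) k :
  (k <= #|D|)%N -> exists S : {set I}, [/\ S \subset D, #|S| = k &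
    forall i j, i \in S -> j \in D :\: S -> f j <= f i].
Proof.
elim: k => [_|k IH kD].
  exists finset.set0; split; rewrite ?finset.sub0set ?cards0// => i j.
  by rewrite inE.
have [S [SD Sk Stop]] := IH (ltnW kD).
have [i0 Hi0] : exists i0, i0 \in D :\: S.
  by apply/finset.set0Pn; rewrite -card_gt0 cardsDS// Sk subn_gt0.
have [i1 i1DS i1max] :=
  @Order.TotalTheory.arg_maxP _ _ I i0 (mem (D :\: S)) f Hi0.
have : i1 \in D :\: S by [].
rewrite inE => /andP[i1S i1D].
exists (i1 |: S)%SET; split => [||i j].
- by rewrite finset.subUset finset.sub1set i1D.
- by rewrite cardsU1 i1S Sk.
- rewrite !inE negb_or -andbA => /predU1P[->|iS] /and3P[_ jS jD].
    by apply: (i1max j); have : j \in D :\: S by rewrite inE jS.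
  by apply: Stop => //; rewrite inE jS.
Qed.

(** * Combinations with prescribed total weight *)

(* The cone r * conv(A), with the weights not yet normalised. *)
Definition conic_comb (R : realType) (V : lmodType R) (A : set V) (r : R)
    (x : V) : Prop :=
  exists l : seq (R * V), [/\ forall q, q \in l -> 0 <= q.1 /\ A q.2,
    \sum_(q <- l) q.1 = r & x = \sum_(q <- l) q.1 *: q.2].

Section conic_comb.
Variables (R : realType) (V : lmodType R) (A : set V).
Implicit Types (r : R) (x y : V).

Lemma conic_comb1 r x : 0 <= r -> A x -> conic_comb A r (r *: x).
Proof.
move=> r0 Ax; exists [:: (r, x)].
by rewrite !big_seq1/=; split => // q /[!inE] /eqP->.
Qed.

(** Concatenating the weighted lists adds the totals; this plays the role of the triangle inequality
    for the gauge of the hull. *)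
Lemma conic_combD r x r' y :
  conic_comb A r x -> conic_comb A r' y -> conic_comb A (r + r') (x + y).
Proof.
move=> [l [Al <- ->]] [l' [Al' <- ->]]; exists (l ++ l').
rewrite !big_cat/=; split => // q.
by rewrite mem_cat => /orP[/Al|/Al'].
Qed.

(** The surplus weight r' - r is placed on the point 0. *)
Lemma conic_comb_le r r' x :
  A 0 -> r <= r' -> conic_comb A r x -> conic_comb A r' x.
Proof.
move=> A0 rr' /(conic_combD (@conic_comb1 (r' - r) 0 _ A0)).
by rewrite scaler0 add0r subrK; apply; rewrite subr_ge0.
Qed.

Lemma conic_comb_hull r x :
  0 < r -> conic_comb A r x -> scale_set r (conv_hull A) x.
Proof.
move=> r0 [l [Al lr ->]].
exists (r^-1 *: \sum_(q <- l) q.1 *: q.2); last first.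
  by rewrite scalerA divff ?gt_eqF// scale1r.
exists (size l), (fun j => r^-1 * (tnth (in_tuple l) j).1),
  (fun j => (tnth (in_tuple l) j).2); split.
- by move=> j; have [] := Al _ (mem_tnth j (in_tuple l)).
- move=> j; rewrite mulr_ge0 ?invr_ge0 ?(ltW r0)//.
  by have [] := Al _ (mem_tnth j (in_tuple l)).
- rewrite -mulr_sumr -(big_tnth _ _ _ xpredT (fun q => q.1)) lr.
  by rewrite mulVf ?gt_eqF.
- rewrite (big_tnth _ _ l) scaler_sumr.
  by apply: eq_bigr => j _; rewrite scalerA.
Qed.

End conic_comb.

(** * Decomposition into sparse blocks of decreasing magnitude *)

Section inclusions.
Variables (R : realType) (d : nat).
Implicit Types (x y t : 'rV[R]_d) (S D : {set 'I_d}) (s : nat) (p c eps : R).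

Lemma zero_sparse s : (B0 R d s `&` B2 R d) 0.
Proof.
split; rewrite /B0 /B2/= ?l2_norm0 ?ler01// /l0_norm.
rewrite (_ : finset _ = finset.set0) ?cards0//.
by apply/setP => i; rewrite !inE mxE eqxx.
Qed.

Lemma conic_comb_sparse s x : (l0_norm x <= s)%N ->
  conic_comb (B0 R d s `&` B2 R d) (l2_norm x) x.
Proof.
move=> xs; have [x0|x0] := eqVneq (l2_norm x) 0.
  rewrite x0 (l2_norm_eq0 x0).
  by have := conic_comb1 (lexx 0) (zero_sparse s); rewrite scale0r.
rewrite -{2}(scalerKV x0 x).
apply: conic_comb1; first exact: l2_norm_ge0.
split; first by apply: leq_trans xs; exact: l0_normZ.
rewrite /B2/= l2_normZ ger0_norm ?invr_ge0 ?l2_norm_ge0//.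
by rewrite mulVf.
Qed.

Lemma l2_norm_restrict_bound s S x c : (#|S| <= s)%N -> 0 <= c ->
  (forall i, i \in S -> `|x 0 i| <= c) ->
  l2_norm (restrict_to S x) <= Num.sqrt s%:R * c.
Proof.
move=> Ss c0 xc; have b0 : 0 <= Num.sqrt s%:R * c by rewrite mulr_ge0.
rewrite -ler_sqr ?nnegrE ?l2_norm_ge0// sqr_l2_norm_restrict.
rewrite exprMn sqr_sqrtr//; apply: (@le_trans _ _ (\sum_(i in S) c ^+ 2)).
  apply: ler_sum => i iS; rewrite -[leLHS]ger0_norm ?sqr_ge0// normrX.
  by rewrite ler_sqr ?nnegrE ?xc.
by rewrite sumr_const -[leLHS]mulr_natl ler_wpM2r ?sqr_ge0// ler_nat.
Qed.

Lemma restrict_setD S D x : S \subset D ->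
  restrict_to D x = restrict_to S x + restrict_to (D :\: S) x.
Proof.
move=> /fintype.subsetP SD; apply/rowP => i; rewrite !mxE inE.
case: (boolP (i \in S)) => [/SD ->|_]/=; first by rewrite addr0.
by rewrite add0r.
Qed.

(* The entries of a block are at most the average of the preceding one, so the
   Euclidean norms of all blocks but the first sum to at most l1 / sqrt s. *)
Lemma block_decomposition s x D : (0 < s)%N ->
  exists S : {set 'I_d}, [/\ S \subset D, (#|S| <= s)%N &
    conic_comb (B0 R d s `&` B2 R d)
      ((Num.sqrt s%:R)^-1 * \sum_(i in D) `|x 0 i|) (restrict_to (D :\: S) x)].
Proof.
move=> s0; have q0 : 0 < Num.sqrt (s%:R : R) by rewrite sqrtr_gt0 ltr0n.
(* Strong induction on the size of D; the set S to be produced is the first block, which is left out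
   of the combination. *)
have [n] := ubnP #|D|; elim: n => // n IH in D * => Dn.
have [Ds|sD] := leqP #|D| s.
  exists D; split => //; rewrite finset.setDv.
  have -> : restrict_to finset.set0 x = 0.
    by apply/rowP => i; rewrite !mxE inE.
  have := conic_comb1 (lexx 0) (zero_sparse s); rewrite scale0r.
  apply: conic_comb_le; first exact: zero_sparse.
  by rewrite mulr_ge0 ?invr_ge0 ?sumr_ge0// ltW.
have [S [SD Ss Stop]] := top_subset (fun i => `|x 0 i|) (ltnW sD).
exists S; rewrite Ss; split => //.
have [S' [S'D S's S'comb]] : exists S' : {set 'I_d},
    [/\ S' \subset D :\: S, (#|S'| <= s)%N &
    conic_comb (B0 R d s `&` B2 R d)
      ((Num.sqrt s%:R)^-1 * \sum_(i in D :\: S) `|x 0 i|)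
      (restrict_to (D :\: S :\: S') x)].
  apply: IH; rewrite -ltnS; apply: leq_trans Dn.
  by rewrite cardsDS// Ss ltnS ltn_subrL s0 (leq_trans s0 (ltnW sD)).
(* The average of the first block S dominates every entry of the next block S'. *)
set c := s%:R^-1 * \sum_(i in S) `|x 0 i|.
have c0 : 0 <= c by rewrite mulr_ge0 ?invr_ge0// sumr_ge0.
have xc j : j \in S' -> `|x 0 j| <= c.
  move=> /(fintype.subsetP S'D) jDS.
  rewrite /c mulrC ler_pdivlMr ?ltr0n// mulr_natr -Ss -sumr_const.
  by apply: ler_sum => i iS; exact: Stop.
rewrite (restrict_setD x S'D).
apply: conic_comb_le (conic_combD (conic_comb_sparse
  (leq_trans (l0_norm_restrict S' x) S's)) S'comb); first exact: zero_sparse.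
rewrite [in leRHS](big_setID S)/= (finset.setIidPr SD) mulrDr lerD2r.
rewrite (le_trans (l2_norm_restrict_bound S's c0 xc))// /c.
(* Since sqrt s / s = 1 / sqrt s, the norm of S' is paid for by the l1 mass of S, while the
   induction hypothesis spends only the mass of D minus S. *)
have -> : s%:R^-1 = (Num.sqrt s%:R)^-1 * (Num.sqrt s%:R)^-1 :> R.
  by rewrite -invfM -expr2 sqr_sqrtr.
by rewrite -mulrA mulVKf ?gt_eqF.
Qed.

Lemma localized_block s x eps : (0 < s)%N ->
  l2_norm x <= eps -> \sum_(i < d) `|x 0 i| <= 2 * (Num.sqrt s%:R * eps) ->
  conic_comb (B0 R d s `&` B2 R d) (3 * eps) x.
Proof.
move=> s0 x2 x1; have q0 : 0 < Num.sqrt (s%:R : R) by rewrite sqrtr_gt0 ltr0n.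
have [S [ST Ss Scomb]] := block_decomposition x [set: 'I_d]%SET s0.
have -> : x = restrict_to S x + restrict_to ([set: 'I_d]%SET :\: S) x.
  by rewrite -restrict_setD//; apply/rowP => i; rewrite mxE inE.
apply: conic_comb_le (conic_combD (conic_comb_sparse
  (leq_trans (l0_norm_restrict S x) Ss)) Scomb); first exact: zero_sparse.
have -> : 3 * eps = eps + 2 * eps by ring.
apply: lerD; first exact: le_trans (l2_norm_restrict_le _ _) x2.
rewrite -(ler_pM2l q0) (mulrCA _ 2) mulVKf ?gt_eqF// (le_trans _ x1)//.
by under eq_bigl do rewrite inE.
Qed.

End inclusions.

(** * The two inclusions with their constants *)

Section constants.
Variables (R : realType) (d : nat).
Implicit Types (x y t : 'rV[R]_d) (s : nat) (p c eps : R).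

Lemma powR_abs_sqr p (u : R) : (u ^+ 2) `^ (p / 2) = `|u| `^ p.
Proof.
by rewrite -(real_normK (num_real u)) -powR_mulrn// -powRrM mulrCA divff ?mulr1.
Qed.

Lemma powRV (u a : R) : 0 <= u -> u^-1 `^ a = (u `^ a)^-1.
Proof. by move=> u0; rewrite -powRN -mulN1r powRrM powR_inv1. Qed.

(** Hölder's bound done entrywise: after division by s^(1-p/2), apply weighted AM-GM to t_i^2 and
    1/s with weight p/2. Over the at most s nonzero entries the bounds sum to at most p/2 + (1 -
    p/2) = 1. *)
Lemma lp_normp_sparse s p t : 0 < p -> p < 1 -> (0 < s)%N ->
  (B0 R d s `&` B2 R d) t -> lp_normp p t <= s%:R `^ (1 - p / 2).
Proof.
move=> p0 p1 s0 [ts t1]; rewrite /B0 /B2/= in ts t1.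
have q0 : 0 < (s%:R : R) by rewrite ltr0n.
have w0 : 0 < s%:R `^ (1 - p / 2) :> R by rewrite powR_gt0.
rewrite -[leRHS]mul1r -ler_pdivrMr//.
set S := [set i | t 0 i != 0]%SET.
have -> : lp_normp p t = \sum_(i in S) `|t 0 i| `^ p.
  rewrite [RHS]big_mkcond; apply: eq_bigr => i _; rewrite inE.
  by case: eqP => //= ->; rewrite normr0 powR0 ?gt_eqF.
rewrite mulr_suml.
have h i : i \in S -> `|t 0 i| `^ p * (s%:R `^ (1 - p / 2))^-1 <=
    p / 2 * t 0 i ^+ 2 + (1 - p / 2) * s%:R^-1.
  move=> _; rewrite -powR_abs_sqr -powRV//.
  by apply: weighted_AMGM; rewrite ?sqr_ge0 ?invr_ge0//; lra.
apply: (le_trans (ler_sum _ h)).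
rewrite big_split/= -mulr_sumr sumr_const -sqr_l2_norm_restrict restrict_support.
have tt : l2_norm t ^+ 2 <= 1 by rewrite expr_le1// l2_norm_ge0.
have cc : (1 - p / 2) * s%:R^-1 *+ #|S| <= 1 - p / 2.
  rewrite -[leLHS]mulr_natr -mulrA -[leRHS]mulr1 ler_wpM2l//; first by lra.
  by rewrite mulrC ler_pdivrMr// mul1r ler_nat.
nra.
Qed.

Lemma scaled_hull_p_sub s p eps : 0 < p -> p < 1 -> 0 < eps -> (0 < s)%N ->
  s%:R <= 2 * eps `^ (- (2 * p / (2 - p))) ->
  scale_set eps (conv_hull_p p (B0 R d s `&` B2 R d))
    `<=` localized_set d p eps.
Proof.
move=> p0 p1 e0 s0 sle _ [_ [m [l [t [At l0 lp ->]]]] <-].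
(* The p-th powers of the weights sum to 1, so each weight is at most 1, hence at most its p-th
   power. *)
have l1 j : l j <= l j `^ p.
  have [->|lj0] := eqVneq (l j) 0; first exact: powR_ge0.
  have ljp : 0 < l j by rewrite lt_neqAle eq_sym lj0 l0.
  apply: ger1_powR; rewrite ?(ltW p1)// ljp/=.
  have : l j `^ p <= 1.
    by rewrite -lp (bigD1 j)//= lerDl sumr_ge0// => i _; exact: powR_ge0.
  apply: contraTT; rewrite -!ltNge => lj1.
  have := gt0_ltr_powR p0 _ _ lj1; rewrite powR1.
  by apply; rewrite nnegrE ?ler01 ?(ltW ljp).
split; last first.
  rewrite l2_normZ gtr0_norm// -[leRHS]mulr1 ler_pM2l//.
  set x := \sum_(j < m) _.
  have [->|x0] := eqVneq (l2_norm x) 0; first exact: ler01.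
  have xp : 0 < l2_norm x by rewrite lt_neqAle eq_sym x0 l2_norm_ge0.
  (* Expanding one factor of <x, x> gives the sum of l_j <t_j, x>, and Cauchy-Schwarz bounds each
     term by l_j times the norm of x. *)
  rewrite -(ler_pM2r xp) -expr2 -inner_self {1}/x inner_suml -lp mulr_suml.
  apply: ler_sum => j _; apply: (@le_trans _ _ (l j * l2_norm x)).
    by rewrite ler_wpM2l//; apply: inner_le_l2_norm; case: (At j).
  by rewrite ler_wpM2r// l2_norm_ge0.
apply: (@le_trans _ _ (eps `^ p * s%:R `^ (1 - p / 2))).
  apply: (@le_trans _ _ (eps `^ p * \sum_(j < m) l j `^ p * lp_normp p (t j))).
    rewrite /lp_normp mulr_sumr; under [leRHS]eq_bigr do rewrite !mulr_sumr.
    rewrite exchange_big/=; apply: ler_sum => i _.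
    rewrite mxE normrM (gtr0_norm e0) powRM// ?(ltW e0)// -mulr_sumr.
    rewrite ler_wpM2l ?powR_ge0// summxE.
    apply: (@le_trans _ _ ((\sum_(j < m) l j * `|t j 0 i|) `^ p)).
      rewrite ge0_ler_powR ?(ltW p0) ?nnegrE ?normr_ge0//.
        by apply: sumr_ge0 => j _; exact: mulr_ge0.
      apply: (le_trans (ler_norm_sum _ _ _)); apply: ler_sum => j _.
      by rewrite mxE normrM ger0_norm.
    apply: (le_trans (powR_le_sum p0 (ltW p1) _)).
      by move=> j; exact: mulr_ge0.
    by apply: ler_sum => j _; rewrite powRM.
  rewrite ler_wpM2l ?powR_ge0//.
  have -> : s%:R `^ (1 - p / 2) =
      \sum_(j < m) l j `^ p * s%:R `^ (1 - p / 2) :> R.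
    by rewrite -mulr_suml lp mul1r.
  by apply: ler_sum => j _; rewrite ler_wpM2l ?powR_ge0// lp_normp_sparse.
apply: (@le_trans _ _ (2 `^ (1 - p / 2))); last first.
  by rewrite -[leRHS]powRr1// ler_powR//; lra.
(* The powers of [eps] cancel because (2p/(2-p)) (1 - p/2) = p. *)
have -> : 2 `^ (1 - p / 2) = eps `^ p *
    (2 * eps `^ (- (2 * p / (2 - p)))) `^ (1 - p / 2) :> R.
  rewrite powRM ?powR_ge0// mulrCA -powRrM -powRD; last first.
    by rewrite (gt_eqF e0) implybT.
  rewrite (_ : p + _ = 0) ?powRr0 ?mulr1//; field; lra.
rewrite ler_wpM2l ?powR_ge0//.
by apply: ge0_ler_powR; rewrite ?nnegrE ?mulr_ge0 ?powR_ge0//; lra.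
Qed.

(** Weighted AM-GM between v^p and v^2. The weight 1/(2-p) on v^p is the one for which the geometric
    mean is v itself. *)
Lemma young_powR p (v : R) : 0 < p -> p < 1 -> 0 <= v ->
  (2 - p) * v <= v `^ p + (1 - p) * v ^+ 2.
Proof.
move=> p0 p1 v0; have q0 : 0 < 2 - p by lra.
have := @weighted_AMGM R (2 - p)^-1 (v `^ p) (v ^+ 2).
have e1 : p * (2 - p)^-1 + 2 * (1 - (2 - p)^-1) = 1 by field; lra.
have -> : (v `^ p) `^ (2 - p)^-1 * (v ^+ 2) `^ (1 - (2 - p)^-1) = v.
  by rewrite -powR_mulrn// -!powRrM -powRD ?e1 ?oner_eq0 ?powRr1.
move=> h.
rewrite -(ler_pM2l (_ : 0 < (2 - p)^-1)) ?invr_gt0// mulKf ?gt_eqF//.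
have e : 1 - (2 - p)^-1 = (2 - p)^-1 * (1 - p) by field; lra.
rewrite mulrDr mulrA -e; apply: h; rewrite ?powR_ge0 ?sqr_ge0 ?invr_gt0//.
by rewrite invf_lt1//; lra.
Qed.

(* c = eps^(2/(2-p)) balances the two terms in the pointwise Young bound. *)
Lemma l1_norm_localized p eps c x : 0 < p -> p < 1 -> 0 < eps -> 0 < c ->
  c `^ (2 - p) = eps ^+ 2 -> localized_set d p eps x ->
  \sum_(i < d) `|x 0 i| <= 2 * (eps ^+ 2 / c).
Proof.
move=> p0 p1 e0 c0 ce [xp x2].
have h i : (2 - p) / c * `|x 0 i| <=
    (c `^ p)^-1 * `|x 0 i| `^ p + (1 - p) / c ^+ 2 * x 0 i ^+ 2.
  have := @young_powR p (`|x 0 i| / c) p0 p1.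
  rewrite powRM ?invr_ge0 ?(ltW c0)// exprMn real_normK ?num_real//.
  rewrite powRV ?(ltW c0)//.
  rewrite divr_ge0 ?(ltW c0)// => /(_ isT); rewrite exprVn.
  by congr (_ <= _); ring.
have cp0 : 0 < c `^ p by exact: powR_gt0.
have : (2 - p) / c * \sum_(i < d) `|x 0 i| <=
    (c `^ p)^-1 * 2 + (1 - p) / c ^+ 2 * eps ^+ 2.
  rewrite mulr_sumr; apply: (le_trans (ler_sum _ (fun i _ => h i))).
  rewrite big_split/= -!mulr_sumr; apply: lerD.
    by rewrite ler_wpM2l ?invr_ge0 ?(ltW cp0).
  rewrite ler_wpM2l//; last first.
    by rewrite -sqr_l2_norm ler_sqr ?nnegrE ?l2_norm_ge0 ?(ltW e0).
  by rewrite divr_ge0 ?sqr_ge0//; lra.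
(* The choice of c turns both terms into multiples of eps^2 / c^2, with total coefficient 3 - p. *)
have -> : (c `^ p)^-1 = eps ^+ 2 / c ^+ 2.
  have -> : eps ^+ 2 = c ^+ 2 / c `^ p.
    rewrite -(powR_mulrn 2 (ltW c0)) -powRB ?ce//.
    by apply/implyP => _; rewrite gt_eqF.
  by field; rewrite !gt_eqF.
have -> : eps ^+ 2 / c ^+ 2 * 2 + (1 - p) / c ^+ 2 * eps ^+ 2 =
  (3 - p) / c * (eps ^+ 2 / c) by field; rewrite gt_eqF.
set E := eps ^+ 2 / c; have E0 : 0 < E by rewrite divr_gt0// exprn_gt0.
set L := \sum_(i < d) _.
rewrite -!mulrA !(mulrCA _ c^-1) ler_pM2l ?invr_gt0// => hL.
(* The factor 2 arises here: 3 - p <= 2 (2 - p) because p < 1. *)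
have : (2 - p) * L <= (2 - p) * (2 * E) by nra.
by rewrite ler_pM2l//; lra.
Qed.

Lemma localized_sub_hull s p eps : 0 < p -> p < 1 -> 0 < eps -> (0 < s)%N ->
  eps `^ (- (2 * p / (2 - p))) <= s%:R ->
  localized_set d p eps
    `<=` scale_set (3 * eps) (conv_hull (B0 R d s `&` B2 R d)).
Proof.
move=> p0 p1 e0 s0 les x xloc; apply: conic_comb_hull; first by rewrite mulr_gt0.
apply: localized_block => //; first by case: xloc.
pose c := eps `^ (2 / (2 - p)).
have c0 : 0 < c by exact: powR_gt0.
have ce : c `^ (2 - p) = eps ^+ 2.
  by rewrite -powRrM divfK ?powR_mulrn ?(ltW e0)// gt_eqF//; lra.
apply: (le_trans (l1_norm_localized p0 p1 e0 c0 ce xloc)).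
(* Cancelling 2 and [eps] leaves eps / c <= sqrt s. Its square is the assumed lower bound on s,
   since 2 - 4/(2-p) = -2p/(2-p). *)
rewrite ler_pM2l// expr2 mulrAC ler_pM2r//.
rewrite -ler_sqr ?nnegrE ?divr_ge0 ?sqrtr_ge0 ?(ltW e0) ?(ltW c0)//.
rewrite sqr_sqrtr//; apply: le_trans les.
have -> : - (2 * p / (2 - p)) = 2 - 2 / (2 - p) * 2 by field; lra.
rewrite powRB; last by apply/implyP => _; rewrite gt_eqF.
by rewrite powRrM !powR_mulrn ?(ltW e0) ?(ltW c0)// exprMn exprVn.
Qed.

End constants.

(** * Support functions against the maximal norm of sparse restrictions *)

Section support_function.
Variables (R : realType) (d : nat).
Implicit Types (x y t : 'rV[R]_d) (S : {set 'I_d}) (s : nat).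

Lemma max_sparse_sqnorm_ge0 s y : 0 <= max_sparse_sqnorm s y.
Proof. exact: bigmax_ge_id. Qed.

(** Restriction to the support of t fixes t and can be moved onto y; Cauchy-Schwarz then applies,
    and the support is an admissible S. *)
Lemma inner_sparse_le s t y : (B0 R d s `&` B2 R d) t ->
  inner t y <= Num.sqrt (max_sparse_sqnorm s y).
Proof.
move=> [ts t1]; rewrite -(restrict_support t) inner_restrict.
set S := finset _; apply: (le_trans (inner_le_l2_norm _ t1)).
rewrite -[leLHS]ger0_norm ?l2_norm_ge0// -sqrtr_sqr ler_wsqrtr//.
by apply: (@bigmax_sup _ _ _ _ S).
Qed.

Lemma inner_hull_le s K x y : 0 <= K ->
  scale_set K (conv_hull (B0 R d s `&` B2 R d)) x ->
  inner x y <= K * Num.sqrt (max_sparse_sqnorm s y).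
Proof.
move=> K0 [_ [m [l [t [At l0 l1 ->]]]] <-].
rewrite innerZl ler_wpM2l// inner_suml -[leRHS]mul1r -l1 mulr_suml.
by apply: ler_sum => j _; rewrite ler_wpM2l// inner_sparse_le.
Qed.

(* Lower bound: eps * y_S / |y_S| has inner product eps * |y_S| with y. *)
Lemma support_fun_sqr_bounds s p eps K (C : set 'rV[R]_d) y :
  0 < eps -> 0 <= K ->
  scale_set eps (conv_hull_p p (B0 R d s `&` B2 R d)) `<=` C ->
  C `<=` scale_set K (conv_hull (B0 R d s `&` B2 R d)) ->
  eps ^+ 2 * max_sparse_sqnorm s y <= support_fun C y ^+ 2
    <= K ^+ 2 * max_sparse_sqnorm s y.
Proof.
move=> e0 K0 subC Csub.
(* A single point with weight 1 is a p-convex combination. *)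
have CZ t : (B0 R d s `&` B2 R d) t -> C (eps *: t).
  move=> At; apply: subC; exists t => //.
  exists 1%N, (fun=> 1), (fun=> t); split => //.
    by rewrite big_ord1 powR1.
  by rewrite big_ord1 scale1r.
have C0 : C 0 by rewrite -(scaler0 _ eps); exact/CZ/zero_sparse.
have inner00 : inner 0 y = 0.
  by rewrite /inner big1// => i _; rewrite mxE mul0r.
(* This bound, together with 0 in C, makes [sup] a genuine supremum rather than its default
   value. *)
have ubC :
    ubound [set inner x y | x in C] (K * Num.sqrt (max_sparse_sqnorm s y)).
  by move=> _ [x /Csub Cx <-]; exact: inner_hull_le.
have leC x : C x -> inner x y <= support_fun C y.
  by move=> Cx; apply: ub_le_sup; [eexists; exact: ubC|exists x].
have sup0 : 0 <= support_fun C y by rewrite -inner00; exact: leC.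
apply/andP; split; last first.
  rewrite -[max_sparse_sqnorm s y](sqr_sqrtr (max_sparse_sqnorm_ge0 _ _)).
  rewrite -exprMn ler_sqr ?nnegrE ?mulr_ge0//.
  by apply: ge_sup => //; exists (inner 0 y), 0.
rewrite mulrC -ler_pdivlMr ?exprn_gt0//; apply: bigmax_le => [|S Ss].
  by rewrite divr_ge0 ?sqr_ge0.
rewrite ler_pdivlMr ?exprn_gt0// mulrC -exprMn.
rewrite ler_sqr ?nnegrE ?mulr_ge0 ?l2_norm_ge0 ?(ltW e0)//.
set N := l2_norm _; have [N0|N0] := eqVneq N 0; first by rewrite N0 mulr0.
have Ngt0 : 0 < N by rewrite lt_neqAle eq_sym N0 l2_norm_ge0.
have -> : eps * N = inner (eps *: (N^-1 *: restrict_to S y)) y.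
  (* Restriction is idempotent, so pairing y_S with y gives the squared norm of y_S. *)
  have rr : restrict_to S (restrict_to S y) = restrict_to S y.
    by apply/rowP => i; rewrite !mxE; case: (i \in S).
  rewrite !innerZl -{1}rr inner_restrict inner_self -/N.
  by rewrite expr2 mulKf.
apply/leC/CZ; split.
  exact: leq_trans (l0_normZ _ _) (leq_trans (l0_norm_restrict _ _) Ss).
by rewrite /B2/= l2_normZ -/N ger0_norm ?invr_ge0 ?l2_norm_ge0// mulVf.
Qed.

End support_function.

(** * Passage to expectations, and rounding of the sparsity level *)

(* The integral of a nonnegative function is a supremum over simple functions,
   whether or not the function is measurable. *)
Lemma ge0_le_integral_nonmeasurable d (T : measurableType d) (R : realType)
    (mu : measure T R) (f g : T -> \bar R) :
  (forall x, 0 <= f x)%E -> (forall x, f x <= g x)%E ->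
  (\int[mu]_x f x <= \int[mu]_x g x)%E.
Proof.
move=> f0 fg; have g0 x : (0 <= g x)%E := le_trans (f0 x) (fg x).
rewrite !ge0_integralE// !patch_setT; apply: ereal_sup_le => _ [h hf <-].
by exists h => // x; exact: le_trans (hf x) (fg x).
Qed.

(** Lets constants be taken out of the expectation. Induction on the enumeration of the subsets
    reduces it to a maximum of two functions. *)
Lemma measurable_max_sparse_sqnorm (R : realType) (dT : measure_display)
    (T : measurableType dT) (P : probability T R) (d s : nat)
    (xi : 'I_d -> {RV P >-> R}) :
  measurable_fun setT (fun w => max_sparse_sqnorm s (random_row xi w)).
Proof.
rewrite /max_sparse_sqnorm; elim: (index_enum _) => [|S r IH].
  by under eq_fun do rewrite big_nil; exact: measurable_cst.
under eq_fun do rewrite big_cons; case: (#|S| <= s)%N => //.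
apply: measurable_maxr => //.
under eq_fun do rewrite sqr_l2_norm_restrict big_mkcond/=.
apply: measurable_sum => i; case: (i \in S) => //.
by under eq_fun do rewrite mxE; exact: measurable_funX.
Qed.

(** The exponent is nonpositive and eps <= 1, so the power A is at least 1 and its ceiling is below
    A + 1 <= 2A. *)
Lemma sparsity_bounds (R : realType) (p eps : R) :
  0 < p -> p < 1 -> 0 < eps -> eps <= 1 ->
  [/\ (0 < sparsity p eps)%N,
    eps `^ (- (2 * p / (2 - p))) <= (sparsity p eps)%:R &
    (sparsity p eps)%:R <= 2 * eps `^ (- (2 * p / (2 - p)))].
Proof.
move=> p0 p1 e0 e1; rewrite /sparsity; set A := eps `^ _.
have A1 : 1 <= A.
  apply: (@le_trans _ _ (eps `^ 0)); first by rewrite powRr0.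
  apply: ger_powR; first by rewrite e0.
  by rewrite oppr_le0 divr_ge0//; lra.
have c0 : 0 <= Num.ceil A by rewrite ceil_ge0; lra.
have -> : `|Num.ceil A|%:R = (Num.ceil A)%:~R :> R.
  by rewrite natr_absz ger0_norm.
have /andP[ltA leA] := ceil_itv A.
split => //.
  by rewrite absz_gt0 gt_eqF// -(ltr_int R); lra.
by rewrite intrB in ltA; lra.
Qed.

Theorem lemma3 (R : realType) (d : nat) (p eps : R) (hd : (1 <= d)%N)
    (hp0 : 0 < p) (hp1 : p < 1)
    (heps_ge : d%:R `^ (- ((2 - p) / (2 * p))) <= eps) (heps_le : eps <= 1) :
  let s := sparsity p eps in
  [/\ scale_set eps (conv_hull_p p (B0 R d s `&` B2 R d))
        `<=` localized_set d p eps,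
      localized_set d p eps
        `<=` scale_set (3 * eps) (conv_hull (B0 R d s `&` B2 R d)) &
      forall (dT : measure_display) (T : measurableType dT)
          (P : probability T R) (xi : 'I_d -> {RV P >-> R}),
        std_gaussian xi ->
        ((eps ^+ 2)%:E * 'E_P[fun w => max_sparse_sqnorm s (random_row xi w)]
           <= 'E_P[fun w => (support_fun (localized_set d p eps)
                               (random_row xi w) ^+ 2)%R])%E /\
        ('E_P[fun w => (support_fun (localized_set d p eps)
                          (random_row xi w) ^+ 2)%R]
           <= (9 * eps ^+ 2)%:E
              * 'E_P[fun w => max_sparse_sqnorm s (random_row xi w)])%E].
Proof.
move=> s.
(* The assumed lower bound on [eps] is a power of d >= 1, hence positive. *)
have e0 : 0 < eps by apply: lt_le_trans heps_ge; rewrite powR_gt0// ltr0n.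
have [s0 sge sle] := sparsity_bounds hp0 hp1 e0 heps_le.
have inc1 := scaled_hull_p_sub (d := d) hp0 hp1 e0 s0 sle.
have inc2 := localized_sub_hull (d := d) hp0 hp1 e0 s0 sge.
split => // dT T P xi _; rewrite unlock.
have K0 : 0 <= 3 * eps by rewrite mulr_ge0 ?(ltW e0).
(* Both inclusions are used at each outcome w, with K = 3 eps, whose square gives the constant 9. *)
have bnd w := support_fun_sqr_bounds (random_row xi w) e0 K0 inc1 inc2.
have e2 : (3 * eps) ^+ 2 = 9 * eps ^+ 2 by ring.
have mM := measurable_max_sparse_sqnorm s xi.
split.
- rewrite -ge0_integralZl_EFin ?sqr_ge0//.
  + apply: ge0_le_integral_nonmeasurable => w; rewrite -EFinM lee_fin.
      by rewrite mulr_ge0 ?sqr_ge0 ?max_sparse_sqnorm_ge0.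
    by case/andP: (bnd w).
  + by move=> w _; rewrite lee_fin max_sparse_sqnorm_ge0.
  + exact/measurable_EFinP.
- rewrite -ge0_integralZl_EFin -?e2 ?sqr_ge0//.
  + apply: ge0_le_integral_nonmeasurable => w; rewrite -?EFinM lee_fin.
      by rewrite sqr_ge0.
    by case/andP: (bnd w).
  + by move=> w _; rewrite lee_fin max_sparse_sqnorm_ge0.
  + exact/measurable_EFinP.
Qed.
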